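(* Suppose $f,g:\mathbb{R}\to\mathbb{R}$ are locally Lipschitz and there are $m\ge1$ and a constant $K=K_m>0$ (independent of $p$ and $y$) such that $$yf(y)+\frac{p-1}{2}g^2(y)\le Kp^m\qquad\text{for all }p>2,\ y\in\mathbb{R}.$$ Assume $m<2$. Then the truncated Euler--Maruyama approximations $y_\Delta(t)$ (defined in the context) for $\mathrm{d}y=f(y)\mathrm{d}t+g(y)\mathrm{d}W$, $y(0)=y_0$, satisfy $$\sup_{\Delta\in(0,1]}\ \sup_{t\in[0,T]}\mathbb{E}\big(e^{q|y_\Delta(t)|}\big)<\infty\qquad\text{for all }q>0 .$$
   Context: $T>0$ is fixed, $W$ is a one-dimensional Brownian motion, $y_0\in\mathbb{R}$ is deterministic. Step sizes are $\Delta=T/N\in(0,1]$ with $N$ a positive integer, $t_k=k\Delta$. Truncation: $\psi:[1,\infty)\to(0,\infty)$ is strictly increasing with $\psi(R)\to+\infty$ as $R\to\infty$, with increasing inverse $\psi^{-1}$ defined on $[\psi(1),\infty)$, and $\sup_{|y|\le R}(|f(y)|\vee|g(y)|)\le\psi(R)$ for all $R\ge1$. The function $h:(0,1]\to[\psi(1),\infty)$ is strictly decreasing with $\lim_{\Delta\to0}h(\Delta)=+\infty$ and $\Delta^{1/4}h(\Delta)\le c_0$ for all $\Delta\in(0,1]$, where $c_0\ge1\vee\psi(1)$ is a constant. Define $$f_\Delta(x)=f\Big(\big(|x|\wedge\psi^{-1}(h(\Delta))\big)\frac{x}{|x|}\Big),\qquad g_\Delta(x)=g\Big(\big(|x|\wedge\psi^{-1}(h(\Delta))\big)\frac{x}{|x|}\Big),$$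 with $x/|x|:=0$ for $x=0$. Truncated Euler--Maruyama approximation: $y_\Delta(0)=y_0$, $y_\Delta(t_{k+1})=y_\Delta(t_k)+\Delta f_\Delta(y_\Delta(t_k))+g_\Delta(y_\Delta(t_k))(W(t_{k+1})-W(t_k))$, extended to continuous time by $$y_\Delta(t)=y_0+\int_0^tf_\Delta(\bar y_\Delta(s))\mathrm{d}s+\int_0^tg_\Delta(\bar y_\Delta(s))\mathrm{d}W(s),\qquad \bar y_\Delta(t)=y_\Delta(t_k)\ \text{for }t\in[t_k,t_{k+1}).$$ *)

(* Defs.v *)
From HB Require Import structures.
From mathcomp Require Import all_boot all_order all_algebra.
From mathcomp Require Import all_classical all_reals all_analysis.

Set Implicit Arguments.
Unset Strict Implicit.
Unset Printing Implicit Defensive.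

Import Order.TTheory GRing.Theory Num.Theory.
Import numFieldNormedType.Exports.

Local Open Scope classical_set_scope.
Local Open Scope ring_scope.

Definition locally_lipschitz (R : realType) (f : R -> R) : Prop :=
  forall r : R, [lipschitz f x | x in `[- r, r]].

Section BrownianMotion.
Context {d : measure_display} {Omega : measurableType d} {R : realType}.
Variable P : probability Omega R.

(* The product rule for subfamilies is the case A i = setT for the other i. *)
Definition mutually_independent (n : nat) (X : 'I_n -> Omega -> R) : Prop :=
  forall A : 'I_n -> set R, (forall i, measurable (A i)) ->
    P (\bigcap_(i in [set: 'I_n]) (X i @^-1` A i)) =
    (\prod_(i < n) P (X i @^-1` A i))%E.

(* Only the times t >= 0 matter: W is unconstrained at negative times. *)
Record brownian_motion (W : R -> Omega -> R) : Prop := BrownianMotion {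
  bm_measurable : forall t, 0 <= t -> measurable_fun [set: Omega] (W t);
  bm_start : {ae P, forall w, W 0 w = 0};
  bm_continuous :
    {ae P, forall w, {within `[0, +oo[, continuous (fun t => W t w)}};
  bm_gaussian : forall s t, 0 <= s -> s < t ->
    forall A : set R, measurable A ->
      P ((W t \- W s) @^-1` A) = normal_prob 0 (Num.sqrt (t - s)) A;
  bm_independent : forall (n : nat) (t : nat -> R), 0 <= t 0 ->
    (forall i, (i < n)%N -> t i <= t i.+1) ->
    mutually_independent (fun i : 'I_n => W (t i.+1) \- W (t i))
}.

End BrownianMotion.

Section TruncatedEulerMaruyama.
Context {R : realType} {Omega : Type}.

Definition step_sizes (T : R) : set R :=
  [set D | 0 < D <= 1 /\ exists2 N : nat, (0 < N)%N & D = T / N%:R].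

(* Since 0^-1 = 0, the convention x / |x| = 0 at x = 0 holds. *)
Definition truncated_coef (psi_inv h : R -> R) (a : R -> R) (D x : R) : R :=
  a (Num.min `|x| (psi_inv (h D)) * (x / `|x|)).

(* Ito integral over [0, t] of a process xi that is constant in time on each
   interval [k D, (k + 1) D[; the terms with k D > t would vanish. *)
Definition ito_step_integral (D : R) (xi W : R -> Omega -> R) (t : R)
    (w : Omega) : R :=
  \sum_(k < (Num.truncn (t / D)).+1)
    xi (k%:R * D) w *
      (W (Num.min t (k.+1%:R * D)) w - W (Num.min t (k%:R * D)) w).

Variables (psi_inv h f g : R -> R) (y0 : R) (W : R -> Omega -> R).

Local Notation fD := (truncated_coef psi_inv h f).
Local Notation gD := (truncated_coef psi_inv h g).

Fixpoint tem_grid (D : R) (k : nat) (w : Omega) : R :=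
  if k is j.+1 then
    let y := tem_grid D j w in
    y + D * fD D y + gD D y * (W (j.+1%:R * D) w - W (j%:R * D) w)
  else y0.

Definition tem_step (D t : R) (w : Omega) : R :=
  tem_grid D (Num.truncn (t / D)) w.

Definition tem (D t : R) (w : Omega) : R :=
  y0 + \int[lebesgue_measure]_(s in `[0, t]) fD D (tem_step D s w)
     + ito_step_integral D (fun s w' => gD D (tem_step D s w')) W t w.

End TruncatedEulerMaruyama.

(* Main.v *)
From HB Require Import structures.
Require Import Defs.
From mathcomp Require Import all_boot all_order all_algebra.
From mathcomp Require Import all_classical all_reals all_analysis.
From mathcomp Require Import measurable_realfun.
From mathcomp Require Import ring lra.

Set Implicit Arguments.
Unset Strict Implicit.
Unset Printing Implicit Defensive.

Import Order.TTheory GRing.Theory Num.Theory.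
Import numFieldNormedType.Exports.
Local Open Scope classical_set_scope.
Local Open Scope ring_scope.

(** The proof runs on the Lyapunov function [exp (lam * V y)] with
    [V y = (1 + y ^+ 2) `^ m^-1]. Since [m < 2], the growth exponent [2 / m] of
    [V] exceeds 1, so for every [q] and every fixed [lam > 0] the quantity
    [q * |y|] is at most [lam * V y] plus a constant ([linear_le_lyapunov]).
    It is therefore enough to bound the expectation of [exp (lam * V)] along
    the scheme for a single small [lam], uniformly in the step size.

    Consider one step [a -> a + del * F + G * x], with [x] centred Gaussian of
    variance [del]. As [1 / m <= 1], [V] is a concave function of [y ^+ 2];
    replacing it by its tangent at [a ^+ 2], of slope [s] after multiplication
    by [lam], turns the exponent into a quadratic polynomial in [x], whose
    exponential moment is explicit ([gaussian_quadratic_mgf]). The bound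
    [D `^ (1/4) * h D <= c0] makes [F ^+ 2 * del] and [G ^+ 2 * del] bounded, so
    for [4 * lam * c0 ^+ 2 <= 1] all discretisation errors are absorbed and the
    logarithm of the moment is at most
      [lam * V a + 2 * del * s * (a * F + (1 + 4 * s * a ^+ 2) * G ^+ 2) + del]
    ([gaussian_step]). The bracket is the left-hand side of the Khasminskii
    type hypothesis for a [p] of order [1 + s * a ^+ 2], that is of order
    [1 + lam * V a]. The hypothesis bounds it by a multiple of [p `^ m], hence
    of [1 + lam * (1 + a ^+ 2)] because [V a `^ m = 1 + a ^+ 2], and after
    multiplication by [s] one is left with a multiple of [lam * V a]
    ([drift_le_lyapunov]). The choice of exponent [1 / m] is exactly what makes
    this last product close up. Truncation does no harm: the coefficients are
    evaluated at a point [b] with [a = rho * b] and [rho >= 1], and the freedom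
    in [p] lets the factor [rho] be split off ([scaled_khasminskii]).

    Consequently a step of length [del] replaces [lam] by at most
    [lam * exp (C * del)] and costs a factor [exp del]. Iterating backwards in
    time from [lam = lam0 * exp (- C * T)] gives the bound
    [exp (lam0 * V y0 + T)] at every time up to [T] ([grid_moment],
    [intermediate_moment]).

    Conditioning on the past is justified by a pi-lambda argument: the grid
    value at time [k * D] is measurable for the sigma-algebra generated by the
    earlier increments, hence independent of the next one
    ([tem_grid_independent]), and Fubini's theorem lets the next increment be
    integrated first ([integral_independent]). *)

(** * Two elementary inequalities *)

(** Concavity of [u `^ th]. By homogeneity this is Bernoulli's inequality at
    [x = u / v], which follows from [1 + z <= expR z] used at both ends of the
    segment that [th * ln x] divides. *)
Lemma powR_le_tangent (R : realType) (th u v : R) :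
  0 < th <= 1 -> 0 < u -> 0 < v ->
  u `^ th <= v `^ th + th * v `^ (th - 1) * (u - v).
Proof.
move=> /andP[th0 th1] u0 v0.
have bernoulli x : 0 < x -> x `^ th <= 1 + th * (x - 1).
  move=> x0; rewrite /powR gt_eqF// -[in leRHS](lnK x0).
  set L := ln x.
  have e1 : expR (th * L) * (1 + (1 - th) * L) <= expR L.
    have -> : expR L = expR (th * L) * expR ((1 - th) * L).
      by rewrite -expRD; congr expR; ring.
    by rewrite ler_pM2l ?expR_gt0// expR_ge1Dx.
  have e2 : expR (th * L) * (1 - th * L) <= 1.
    have -> : expR (th * L) * (1 - th * L) <= 1 =
              (expR (th * L) * (1 - th * L) <=
               expR (th * L) * expR (- (th * L))).
      by rewrite expRN divff ?gt_eqF ?expR_gt0.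
    by rewrite ler_pM2l ?expR_gt0// expR_ge1Dx.
  have th1' : 0 <= 1 - th by rewrite subr_ge0.
  have h := lerD (ler_wpM2l (ltW th0) e1) (ler_wpM2l th1' e2).
  have -> : expR (th * L) = th * (expR (th * L) * (1 + (1 - th) * L)) +
      (1 - th) * (expR (th * L) * (1 - th * L)) by ring.
  by apply: (le_trans h); lra.
have v0' := ltW v0; have vth := powR_gt0 th v0.
have -> : u `^ th = v `^ th * (u / v) `^ th.
  by rewrite -powRM ?divr_ge0 ?(ltW u0)// mulrC divfK// gt_eqF.
have -> : v `^ th + th * v `^ (th - 1) * (u - v) =
          v `^ th * (1 + th * (u / v - 1)).
  rewrite -(mulr_powRB1 v0' th0); field; exact: lt0r_neq0.
by rewrite ler_pM2l// bernoulli// divr_gt0.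
Qed.

Lemma inv_sqrt_le_expR (R : realType) (x : R) : 0 <= x <= 4^-1 ->
  (Num.sqrt (1 - 2 * x))^-1 <= expR (2 * x).
Proof.
move=> /andP[x0 x4].
have h0 : 0 < 1 - 2 * x by lra.
rewrite -[leRHS]invrK lef_pV2 ?posrE ?sqrtr_gt0// ?invr_gt0 ?expR_gt0//.
rewrite -(ler_pXn2r (_ : (0 < 2)%N)) ?nnegrE ?invr_ge0 ?expR_ge0 ?sqrtr_ge0//.
rewrite sqr_sqrtr ?(ltW h0)//.
have -> : (expR (2 * x))^-1 ^+ 2 = (expR (4 * x))^-1.
  by rewrite -!expRN -expRM_natl; congr expR; ring.
rewrite -[leRHS]invrK lef_pV2 ?posrE ?invr_gt0 ?expR_gt0//.
apply: le_trans (expR_ge1Dx _).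
by rewrite -div1r ler_pdivrMr//; nra.
Qed.

(** * Exponential moments of Gaussian variables *)

(** The density agrees almost everywhere with the Radon-Nikodym derivative,
    for which the change of variables is known. *)
Lemma ge0_integral_normal_prob (R : realType) (m s : R) (f : R -> \bar R) :
  (forall x, 0 <= f x)%E -> measurable_fun setT f ->
  (\int[normal_prob m s]_x f x =
   \int[lebesgue_measure]_x (f x * (normal_pdf m s x)%:E))%E.
Proof.
move=> f0 mf; have dom := normal_prob_dominates m s.
rewrite -(Radon_Nikodym_SigmaFinite.change_of_variables dom f0)//=.
have rn_int := Radon_Nikodym_SigmaFinite.f_integrable dom.
have mpdf : measurable_fun setT (fun x : R => (normal_pdf m s x)%:E).
  by apply/measurable_EFinP; exact: measurable_normal_pdf.
apply: ae_eq_integral => //.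
- apply: emeasurable_funM => //; exact: (measurable_int lebesgue_measure).
- exact: emeasurable_funM.
- apply: ae_eqe_mul2l; apply: integral_ae_eq => //.
  by move=> A _ mA; rewrite -Radon_Nikodym_SigmaFinite.f_integral.
Qed.

(** Completing the square shows that the integrand times the Gaussian density
    is a constant times the density with mean [be * var] and variance
    [var = del / (1 - 2 * al * del)], which integrates to 1. *)
Lemma gaussian_quadratic_mgf (R : realType) (del al be : R) :
  0 < del -> 2 * al * del < 1 ->
  (\int[normal_prob 0%R (Num.sqrt del)]_x (expR (al * x ^+ 2 + be * x))%:E =
   ((Num.sqrt (1 - 2 * al * del))^-1 *
     expR (be ^+ 2 * del / (2 * (1 - 2 * al * del))))%:E)%E.
Proof.
move=> del0 aldel; set c := 1 - 2 * al * del.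
have c0 : 0 < c by rewrite /c; lra.
have c0' := lt0r_neq0 c0; have del0' := lt0r_neq0 del0.
pose var := del / c; have var0 : 0 < var by rewrite divr_gt0.
have sd0 : Num.sqrt del != 0 by rewrite gt_eqF// sqrtr_gt0.
have sv0 : Num.sqrt var != 0 by rewrite gt_eqF// sqrtr_gt0.
have mf : measurable_fun setT (fun x : R => (expR (al * x ^+ 2 + be * x))%:E).
  apply/measurable_EFinP; apply: measurableT_comp => //.
  by apply: measurable_funD; apply: measurable_funM.
rewrite ge0_integral_normal_prob//.
set C := (_ * expR (be ^+ 2 * _ / _)).
have C0 : 0 <= C by rewrite mulr_ge0 ?expR_ge0// invr_ge0 sqrtr_ge0.
transitivity (C%:E * \int[lebesgue_measure]_x
    (normal_pdf (be * var) (Num.sqrt var) x)%:E)%E; last first.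
  by rewrite integral_normal_pdf mule1.
have mpdf : measurable_fun [set: R]
    (fun x : R => (normal_pdf (be * var) (Num.sqrt var) x)%:E).
  by apply/measurable_EFinP; exact: measurable_normal_pdf.
have pdf0 x : [set: R] x ->
    (0 <= (normal_pdf (be * var) (Num.sqrt var) x)%:E)%E.
  by move=> _; rewrite lee_fin normal_pdf_ge0.
rewrite -(ge0_integralZl_EFin lebesgue_measure measurableT pdf0 mpdf C0).
apply: eq_integral => x _; rewrite -!EFinM /C; congr EFin.
rewrite !normal_pdfE// /normal_peak /normal_fun !sqr_sqrtr ?ltW//.
have -> : Num.sqrt (var * pi *+ 2) = Num.sqrt (del * pi *+ 2) / Num.sqrt c.
  rewrite -sqrtrV ?ltW// -sqrtrM; last first.
    by rewrite mulrn_wge0// mulr_ge0 ?pi_ge0// ltW.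
  by congr Num.sqrt; rewrite /var; field.
have pk0 : Num.sqrt (del * pi *+ 2) != 0.
  by rewrite gt_eqF// sqrtr_gt0 mulrn_wgt0// mulr_gt0// pi_gt0.
have sc0 : Num.sqrt c != 0 by rewrite gt_eqF// sqrtr_gt0.
rewrite [RHS](_ : _ = (Num.sqrt (del * pi *+ 2))^-1 *
  (expR (be ^+ 2 * del / (2 * c)) *
   expR (- (x - be * var) ^+ 2 / (var *+ 2)))); last first.
  by field; rewrite pk0 sc0.
rewrite mulrCA -!expRD; congr (_ * expR _).
rewrite /var subr0 /c; field.
by rewrite del0' /= -/c c0'.
Qed.

(** * The Lyapunov function and one Euler step *)

Definition lyapunov (R : realType) (th y : R) : R := (1 + y ^+ 2) `^ th.

(** [lam] times the derivative of [u |-> u `^ th] at [u = 1 + y ^+ 2], i.e. the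
    slope of [lam * lyapunov th] as a function of [y ^+ 2]. *)
Definition lyapunov_slope (R : realType) (th lam y : R) : R :=
  lam * th * (1 + y ^+ 2) `^ (th - 1).

Lemma lyapunov_ge0 (R : realType) (th y : R) : 0 <= lyapunov th y.
Proof. exact: powR_ge0. Qed.

Lemma measurable_lyapunov (R : realType) (th : R) :
  measurable_fun [set: R] (lyapunov th).
Proof.
apply: (measurableT_comp (measurable_powR th)).
by apply: measurable_funD => //; exact: measurable_funX.
Qed.

(** [11 = 3 + 8] bounds the sum by its larger term; the constants come from the
    choice of [p] in [drift_le_lyapunov]. *)
Lemma powR_le_sum (R : realType) (m x : R) : 0 <= m -> 0 <= x ->
  (3 + 8 * x) `^ m <= 11 `^ m * (1 + x `^ m).
Proof.
move=> m0 x0; have e0 := powR_ge0 (11:R) m; have x1 := powR_ge0 x m.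
have [x_le1|x_gt1] := leP x 1.
  apply: (@le_trans _ _ (11 `^ m)); last by rewrite ler_peMr// lerDl.
  by apply: ge0_ler_powR => //; rewrite ?nnegrE; lra.
apply: (@le_trans _ _ ((11 * x) `^ m)).
  by apply: ge0_ler_powR => //; rewrite ?nnegrE; lra.
by rewrite powRM// ler_wpM2l// lerDr.
Qed.

(** Truncation only shrinks a point, and the threshold is at least 1, so the
    factor is at most [max 1 |a|], which [1 + a ^+ 2] dominates. *)
Lemma truncation_factor (R : realType) (r a : R) : 1 <= r ->
  exists2 rho, a = rho * (Num.min `|a| r * (a / `|a|)) &
    1 <= rho /\ rho <= 1 + a ^+ 2.
Proof.
move=> r1; have a0 := normr_ge0 a; have aa := real_normK (num_real a).
have r0 : 0 < r by lra.
have [->|an0] := eqVneq a 0.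
  by exists 1; [rewrite mul0r !mulr0|rewrite expr0n/=; split; lra].
have na0 : `|a| != 0 by rewrite normr_eq0.
have [ar|ra] := leP `|a| r.
  exists 1; first by field.
  by split => //; rewrite lerDl sqr_ge0.
exists (`|a| / r); first by field; rewrite na0/= lt0r_neq0.
split; first by rewrite ler_pdivlMr// mul1r ltW.
rewrite ler_pdivrMr// -aa.
nra.
Qed.

Section drift.
Context {R : realType}.
Variables (m K : R) (f g : R -> R).
Hypotheses (m1 : 1 <= m) (K0 : 0 < K).
Hypothesis hfg : forall p y : R, 2 < p ->
  y * f y + (p - 1) / 2 * (g y) ^+ 2 <= K * (p `^ m).

(** The hypothesis at [b] with [p = 3 + 2 * c / rho], multiplied by [rho]: the
    coefficient of [g b ^+ 2] becomes [rho + c >= 1 + c]. Dividing [c] by [rho]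
    inside [p] is what keeps the right-hand side of order [c `^ m] for large
    [c], in spite of the factor [rho]. *)
Lemma scaled_khasminskii (a b rho c : R) : a = rho * b -> 1 <= rho -> 0 <= c ->
  a * f b + (1 + c) * g b ^+ 2 <= rho * (K * (3 + 2 * c / rho) `^ m).
Proof.
move=> -> rho1 c0; have rho0 : 0 < rho by lra.
have cr : 0 <= c / rho by rewrite divr_ge0// ltW.
have := @hfg (3 + 2 * c / rho) b.
rewrite -(ler_pM2l rho0) => h.
apply: le_trans (h _); last by rewrite -mulrA; lra.
have -> : rho * (b * f b + (3 + 2 * c / rho - 1) / 2 * g b ^+ 2) =
  rho * b * f b + (rho + c) * g b ^+ 2 by field; exact: lt0r_neq0.
by rewrite lerD2l ler_wpM2r ?sqr_ge0// lerD2r.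
Qed.

(** With [v = 1 + a ^+ 2] and [w = v `^ m^-1], the parameter [p] is at most
    [3 + 8 * x] for [x = lam * w / rho], and [x `^ m <= lam * v / rho] since
    [w `^ m = v]. The slope [s] satisfies [s * v <= lam * w], which brings the
    product back to the order of [lam * w]. *)
Lemma drift_le_lyapunov (a b rho lam : R) :
  a = rho * b -> 1 <= rho -> rho <= 1 + a ^+ 2 -> 0 < lam <= 1 ->
  lyapunov_slope m^-1 lam a *
    (a * f b + (1 + 4 * lyapunov_slope m^-1 lam a * a ^+ 2) * g b ^+ 2) <=
  2 * 11 `^ m * K * (lam * lyapunov m^-1 a).
Proof.
move=> ab rho1 rhov /andP[lam0 lam1].
have m0 : 0 < m by exact: lt_le_trans m1.
have im0 : 0 < m^-1 by rewrite invr_gt0.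
have im1 : m^-1 <= 1 by rewrite invf_le1.
have rho0 : 0 < rho by lra.
have a2 := sqr_ge0 a.
set v := 1 + a ^+ 2 in rhov *; have v1 : 1 <= v by rewrite lerDl.
have v0 : 0 < v by lra.
rewrite /lyapunov -/v; set s := lyapunov_slope _ _ _; set w := v `^ m^-1.
have w0 : 0 < w by rewrite powR_gt0.
have wm : w `^ m = v by rewrite -powRrM mulVf ?lt0r_neq0// powRr1// ltW.
have s0 : 0 < s by rewrite /s /lyapunov_slope !mulr_gt0// powR_gt0.
have sv : s * v = lam * m^-1 * w.
  by rewrite /s /lyapunov_slope -mulrA (mulrC (_ `^ _)) mulr_powRB1// ltW.
have svw : s * v <= lam * w.
  by rewrite sv ler_pM2r// ger_pMr.
have sa2 : s * a ^+ 2 <= lam * w.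
  by apply: le_trans svw; rewrite ler_pM2l// /v lerDr.
pose x := lam * w / rho.
have x0 : 0 < x by rewrite /x !mulr_gt0// invr_gt0.
have c0 : 0 <= 4 * s * a ^+ 2 by rewrite mulr_ge0// mulr_ge0// ltW.
apply: (@le_trans _ _ (s * (rho * (K * (11 `^ m * (1 + x `^ m)))))).
  rewrite ler_pM2l//; apply: le_trans (scaled_khasminskii ab rho1 c0) _.
  rewrite !ler_pM2l//; apply: le_trans (powR_le_sum (ltW m0) (ltW x0)).
  apply: ge0_ler_powR; rewrite ?nnegrE ?(ltW m0)//.
  - by rewrite addr_ge0// divr_ge0 ?(ltW rho0)// mulr_ge0.
  - by rewrite addr_ge0// mulr_ge0// ltW.
  rewrite lerD2l.
  have -> : 2 * (4 * s * a ^+ 2) / rho = 8 * (s * a ^+ 2 / rho) by ring.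
  by rewrite ler_pM2l// ler_pM2r ?invr_gt0.
have xm : x `^ m <= lam * v / rho.
  have -> : x = (lam / rho) * w by rewrite /x; field; exact: lt0r_neq0.
  have l0 : 0 < lam / rho by rewrite divr_gt0.
  rewrite powRM ?(ltW w0) ?(ltW l0)// wm mulrAC ler_wpM2r ?(ltW v0)//.
  by apply: ge1r_powR => //; rewrite l0/= ler_pdivrMr// mul1r; lra.
have e0 : 0 < (11:R) `^ m by rewrite powR_gt0.
apply: (@le_trans _ _ (s * (rho * (K * (11 `^ m * (1 + lam * v / rho)))))).
  by rewrite !ler_pM2l// lerD2l.
have -> : s * (rho * (K * (11 `^ m * (1 + lam * v / rho)))) =
          11 `^ m * K * (s * (rho + lam * v)) by field; exact: lt0r_neq0.
have -> : 2 * 11 `^ m * K * (lam * w) = 11 `^ m * K * (2 * (lam * w)) by ring.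
rewrite ler_pM2l ?mulr_gt0//.
apply: (@le_trans _ _ (s * (2 * v))).
  rewrite ler_pM2l//.
  have : lam * v <= v by rewrite ger_pMl.
  lra.
by rewrite mulrCA ler_pM2l.
Qed.
End drift.

(** The exponent is bounded by its tangent, a quadratic [al * x ^+ 2 + be * x]
    up to constants. Since [1 - 2 * al * del >= 1/2], the denominators in the
    Gaussian moment cost at most a factor 2 in the exponent; a larger
    coefficient of [G ^+ 2] is affordable because the drift is controlled for
    all [p]. The terms with [del ^+ 2 * F ^+ 2] sum up to at most [del]. *)
Lemma gaussian_step (R : realType) (th lam c del F G a : R) :
  0 < th <= 1 -> 0 < lam -> 4 * lam * c ^+ 2 <= 1 -> 0 < del ->
  F ^+ 2 * del <= c ^+ 2 -> G ^+ 2 * del <= c ^+ 2 ->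
  (\int[normal_prob 0%R (Num.sqrt del)]_x
     (expR (lam * lyapunov th (a + del * F + G * x)))%:E <=
   (expR (lam * lyapunov th a +
      2 * del * (lyapunov_slope th lam a *
        (a * F + (1 + 4 * lyapunov_slope th lam a * a ^+ 2) * G ^+ 2)) +
      del))%:E)%E.
Proof.
move=> /andP[th0 th1] lam0 lamc del0 Fc Gc.
set s := lyapunov_slope _ _ _.
have a2 := sqr_ge0 a.
have v1 : 1 <= 1 + a ^+ 2 by rewrite lerDl.
have v0 : 0 < 1 + a ^+ 2 by lra.
have s0 : 0 < s by rewrite /s /lyapunov_slope !mulr_gt0// powR_gt0.
have s_lam : s <= lam.
  have : (1 + a ^+ 2) `^ (th - 1) <= 1.
    have th' : th - 1 <= 0 by lra.
    by apply: le_trans (ler_powR v1 th') _; rewrite powRr0.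
  have := powR_ge0 (1 + a ^+ 2) (th - 1); rewrite /s /lyapunov_slope.
  set z := _ `^ _ => z0 z1.
  rewrite -mulrA ger_pMr//; nra.
have sc : 4 * s * c ^+ 2 <= 1.
  apply: le_trans lamc; rewrite ler_wpM2r ?sqr_ge0//; lra.
pose al := s * G ^+ 2; pose be := 2 * s * (a + del * F) * G.
pose e0 := lam * lyapunov th a + s * (2 * a * del * F + del ^+ 2 * F ^+ 2).
have pointwise x : lam * lyapunov th (a + del * F + G * x) <=
    e0 + (al * x ^+ 2 + be * x).
  have u0 : 0 < 1 + (a + del * F + G * x) ^+ 2 by rewrite ltr_wpDr ?sqr_ge0.
  have := powR_le_tangent (th := th) (_ : 0 < th <= 1) u0 v0.
  rewrite th0 th1 => /(_ isT); rewrite -(ler_pM2l lam0) => h.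
  rewrite /lyapunov; apply: le_trans h _.
  rewrite le_eqVlt; apply/orP; left; apply/eqP.
  by rewrite /e0 /al /be /s /lyapunov_slope /lyapunov; ring.
have ald0 : 0 <= al * del.
  apply: mulr_ge0; last exact: ltW.
  by apply: mulr_ge0; [exact: ltW|exact: sqr_ge0].
have ald : al * del <= 4^-1.
  rewrite /al -mulrA; apply: (@le_trans _ _ (s * c ^+ 2)); last lra.
  by rewrite ler_pM2l.
have meas : measurable_fun [set: R]
    (fun x : R => (expR (al * x ^+ 2 + be * x))%:E).
  apply/measurable_EFinP; apply: measurableT_comp => //.
  by apply: measurable_funD; apply: measurable_funM.
apply: (@le_trans _ _ (\int[normal_prob 0%R (Num.sqrt del)]_x
     ((expR e0)%:E * (expR (al * x ^+ 2 + be * x))%:E))%E).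
  apply: ge0_le_integral => //.
  - apply/measurable_EFinP; apply: measurableT_comp => //.
    apply: measurable_funM => //; apply: measurableT_comp.
      exact: measurable_lyapunov.
    by apply: measurable_funD => //; exact: measurable_funM.
  - exact: emeasurable_funM.
  - by move=> x _; rewrite -EFinM lee_fin -expRD ler_expR.
rewrite ge0_integralZl_EFin ?expR_ge0// gaussian_quadratic_mgf//; last lra.
rewrite -EFinM lee_fin.
have h1 : (Num.sqrt (1 - 2 * al * del))^-1 <= expR (2 * (al * del)).
  by rewrite -[2 * al * del]mulrA inv_sqrt_le_expR// ald0.
have h2 : be ^+ 2 * del / (2 * (1 - 2 * al * del)) <= be ^+ 2 * del.
  have bd : 0 <= be ^+ 2 * del by rewrite mulr_ge0 ?sqr_ge0 ?ltW.
  rewrite ler_pdivrMr; last by lra.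
  by rewrite ler_peMr//; lra.
apply: (@le_trans _ _
    (expR e0 * (expR (2 * (al * del)) * expR (be ^+ 2 * del)))).
  rewrite ler_pM2l ?expR_gt0//; apply: ler_pM; rewrite ?expR_ge0//.
  by rewrite ler_expR.
rewrite -!expRD ler_expR /e0.
(* The cross term of the square is removed by the parallelogram inequality,
   [(a + b) ^+ 2 <= 2 * (a ^+ 2 + b ^+ 2)]. *)
have h3 : be ^+ 2 * del <= 8 * s * (al * del) * (a ^+ 2 + del ^+ 2 * F ^+ 2).
  have -> : be ^+ 2 * del = 4 * s * (al * del) * (a + del * F) ^+ 2.
    by rewrite /be /al; ring.
  have -> : 8 * s * (al * del) * (a ^+ 2 + del ^+ 2 * F ^+ 2) =
    4 * s * (al * del) * (2 * (a ^+ 2 + del ^+ 2 * F ^+ 2)) by ring.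
  apply: ler_wpM2l; first by rewrite mulr_ge0// mulr_ge0// ltW.
  have := sqr_ge0 (a - del * F); nra.
have d2 : 0 <= s * (del ^+ 2 * F ^+ 2).
  by rewrite mulr_ge0 ?(ltW s0)// mulr_ge0 ?sqr_ge0.
have h4 : 8 * s * (al * del) * (del ^+ 2 * F ^+ 2) <=
    2 * (s * (del ^+ 2 * F ^+ 2)).
  have -> : 8 * s * (al * del) * (del ^+ 2 * F ^+ 2) =
    (8 * (al * del)) * (s * (del ^+ 2 * F ^+ 2)) by ring.
  apply: ler_wpM2r => //; lra.
have h5 : 3 * (s * (del ^+ 2 * F ^+ 2)) <= del.
  have -> : 3 * (s * (del ^+ 2 * F ^+ 2)) = (3 * s * (F ^+ 2 * del)) * del.
    by ring.
  rewrite ger_pMl//; apply: (@le_trans _ _ (3 * s * c ^+ 2)).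
    by rewrite ler_pM2l// mulr_gt0.
  have := mulr_ge0 (ltW s0) (sqr_ge0 c); lra.
have -> : 2 * del * (s * (a * F + (1 + 4 * s * a ^+ 2) * G ^+ 2)) =
  s * (2 * a * del * F) + 2 * (al * del) + 8 * s * (al * del) * a ^+ 2.
  by rewrite /al; ring.
lra.
Qed.

(** * Independence of the past *)

Section independence.
Context {d : measure_display} {Omega : measurableType d} {R : realType}.
Variable P : probability Omega R.

(** The pi-system generating the sigma-algebra of all the variables but the
    last; leaving the last one unconstrained, instead of dropping it, lets the
    product rule for the whole family apply directly. *)
Definition past_cylinders (n : nat) (X : 'I_n.+1 -> Omega -> R) :
    set (set Omega) :=
  [set B | exists A : 'I_n.+1 -> set R,
     [/\ forall i, measurable (A i), A ord_max = setT &
      B = \bigcap_(i in [set: 'I_n.+1]) (X i @^-1` A i)]].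

Lemma past_cylinders_measurable (n : nat) (X : 'I_n.+1 -> Omega -> R) :
  (forall i, measurable_fun setT (X i)) -> past_cylinders X `<=` measurable.
Proof.
move=> mX _ [A [mA _ ->]]; apply: fin_bigcap_measurable => // i _.
by rewrite -[X in measurable X]setTI; exact: mX.
Qed.

(** For fixed [A], both sides are finite measures in [B] that agree on the
    generating pi-system, hence on the generated sigma-algebra. *)
Lemma generated_past_independent (n : nat) (X : 'I_n.+1 -> Omega -> R) :
  (forall i, measurable_fun setT (X i)) -> mutually_independent P X ->
  forall (B : set Omega) (A : set R), <<s past_cylinders X>> B ->
  measurable A ->
  P (B `&` X ord_max @^-1` A) = (P B * P (X ord_max @^-1` A))%E.
Proof.
move=> mX indep B A sB mA.
have mE : measurable (X ord_max @^-1` A).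
  by rewrite -[X in measurable X]setTI; exact: mX.
set E := X ord_max @^-1` A.
have PE0 : 0 <= fine (P E) by rewrite fine_ge0.
have PEE : P E = (fine (P E))%:E by rewrite fineK// fin_num_measure.
rewrite muleC PEE.
apply: (@g_sigma_algebra_measure_unique _ _ _ (past_cylinders X) _ (fun=> setT)
  _ _ (mrestr P mE) (mscale (NngNum PE0) P)) => //.
- exact: past_cylinders_measurable.
- move=> _; exists (fun=> setT); split => //.
  by apply/seteqP; split.
- by rewrite bigcup_const//; exists 0%N.
- move=> _ _ [A1 [mA1 A1T ->]] [A2 [mA2 A2T ->]].
  exists (fun i => A1 i `&` A2 i); split.
  + by move=> i; exact: measurableI.
  + by rewrite A1T A2T setTI.
  + by rewrite -bigcapI.
- move=> _ [A1 [mA1 A1T ->]].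
  rewrite [RHS](_ : _ =
    (P E * P (\bigcap_(i in [set: 'I_n.+1]) (X i @^-1` A1 i)))%E); last first.
    by rewrite [in RHS]PEE.
  rewrite /= {1}/mrestr.
  (* Intersecting with [E] replaces the trivial constraint on the last
     variable by [A]. *)
  pose A2 i := if i == ord_max then A else A1 i.
  have -> : \bigcap_(i in [set: 'I_n.+1]) (X i @^-1` A1 i) `&` E =
      \bigcap_(i in [set: 'I_n.+1]) (X i @^-1` A2 i).
    apply/seteqP; split => [w [h1 h2] i _|w h].
      by rewrite /A2 /preimage /=; case: eqP => [->//|_]; exact: h1.
    split => [i _|]; last by have := h ord_max I; rewrite /A2 /preimage/= eqxx.
    have := h i I; rewrite /A2 /preimage /=; case: eqP => // -> _.
    by rewrite A1T.
  rewrite !indep//; last by move=> i; rewrite /A2; case: ifP.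
  rewrite !big_ord_recr/= A1T preimage_setT probability_setT mule1.
  rewrite {2}/A2 eqxx muleC; congr (_ * _)%E.
  apply: eq_bigr => i _; rewrite /A2 ifF//.
  by apply/negbTE; rewrite neq_ltn /= ltn_ord.
- by move=> _; rewrite /= /mrestr setTI; rewrite ltey_eq fin_num_measure.
Qed.

(** Independence says that the joint law is the product of the marginal laws, so
    Tonelli's theorem integrates [Z] first. *)
Lemma integral_independent (d1 d2 : measure_display)
    (T1 : measurableType d1) (T2 : measurableType d2)
    (Y : Omega -> T1) (Z : Omega -> T2) (Phi : T1 * T2 -> \bar R) :
  measurable_fun setT Y -> measurable_fun setT Z ->
  (forall A B, measurable A -> measurable B ->
    P (Y @^-1` A `&` Z @^-1` B) = (P (Y @^-1` A) * P (Z @^-1` B))%E) ->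
  measurable_fun setT Phi -> (forall z, 0 <= Phi z)%E ->
  (\int[P]_w Phi (Y w, Z w) = \int[P]_w \int[P]_w' Phi (Y w, Z w'))%E.
Proof.
move=> mY mZ indep mPhi Phi0.
pose Y' : {mfun Omega >-> T1} := HB.pack Y (isMeasurableFun.Build _ _ _ _ _ mY).
pose Z' : {mfun Omega >-> T2} := HB.pack Z (isMeasurableFun.Build _ _ _ _ _ mZ).
have mYZ : measurable_fun setT (fun w => (Y w, Z w)).
  exact: measurable_fun_pair.
pose YZ : {mfun Omega >-> (T1 * T2)%type} :=
  HB.pack (fun w => (Y w, Z w)) (isMeasurableFun.Build _ _ _ _ _ mYZ).
have -> : (\int[P]_w Phi (Y w, Z w) = \int[distribution P YZ]_z Phi z)%E.
  by rewrite ge0_integral_distribution.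
pose m1 : {sigma_finite_measure set T1 -> \bar R} := distribution P Y'.
pose m2 : {sigma_finite_measure set T2 -> \bar R} := distribution P Z'.
have -> : (\int[distribution P YZ]_z Phi z = \int[m1 \x m2]_z Phi z)%E.
  apply: eq_measure_integral => A mA _; apply/esym.
  exact: product_measure_unique.
rewrite fubini_tonelli1// ge0_integral_distribution//=; last first.
- by move=> x; apply: integral_ge0.
- exact: measurable_fun_fubini_tonelli_F.
apply: eq_integral => w _; rewrite /fubini_F ge0_integral_distribution//.
exact: measurableT_comp.
Qed.
End independence.

(** * Measurability and independence for the scheme *)

Lemma locally_lipschitz_continuous (R : realType) (f : R -> R) :
  locally_lipschitz f -> continuous f.
Proof.
move=> lip x; have [M0 [M0r lipM]] := lip (`|x| + 1).
pose M := Num.max M0 0 + 1.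
have M0M : M0 < M by rewrite ltr_pwDr// le_max lexx.
have Mgt0 : 0 < M by rewrite ltr_pwDr// le_max lexx orbT.
have {}lipM := lipM _ M0M.
apply/cvgrPdist_le => e e0.
near=> y.
have xy1 : `|x - y| <= 1 by near: y; exact: cvgr_dist_le.
have xye : `|x - y| <= e / M.
  near: y; apply: cvgr_dist_le => //; exact: divr_gt0.
have := lipM (x, y); rewrite /= => /(_ _)/le_trans; apply.
  split; rewrite in_itv/= -ler_norml; first by rewrite lerDl.
  rewrite -[y](subrK x); apply: (le_trans (ler_normD _ _)).
  by rewrite addrC lerD2l distrC.
by rewrite mulrC -ler_pdivlMr.
Unshelve. all: by end_near. Qed.

(** The truncation is the clamp to [[- r, r]], which is visibly measurable,
    whereas the quotient [x / |x|] is awkward at 0. *)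
Lemma truncationE (R : realType) (r x : R) : 0 <= r ->
  Num.min `|x| r * (x / `|x|) = Num.max (- r) (Num.min x r).
Proof.
move=> r0; have [->|xn0] := eqVneq x 0.
  by rewrite mul0r mulr0 min_l// max_r// oppr_le0.
have [x0|x0] := leP 0 x.
  rewrite ger0_norm// divff// mulr1 max_r// le_min.
  by rewrite (le_trans _ x0) ?oppr_le0// (le_trans _ r0) ?oppr_le0.
rewrite ltr0_norm// invrN mulrN divff// mulrN1 (min_l (x := x)); last first.
  by rewrite (le_trans (ltW x0)).
by rewrite oppr_min opprK maxC.
Qed.

Lemma measurable_truncated_coef (R : realType) (psi_inv h a : R -> R) (D : R) :
  0 <= psi_inv (h D) -> measurable_fun setT a ->
  measurable_fun setT (truncated_coef psi_inv h a D).
Proof.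
move=> r0 ma; rewrite /truncated_coef.
under eq_fun do rewrite truncationE//.
apply: (measurableT_comp ma).
by apply: measurable_maxr => //; exact: measurable_minr.
Qed.

Section scheme_measurability.
Context {d : measure_display} {Omega : measurableType d} {R : realType}.
Variables (P : probability Omega R) (W : R -> Omega -> R).
Hypothesis hW : brownian_motion P W.
Variables (psi_inv h f g : R -> R) (y0 D : R).
Hypothesis D0 : 0 < D.
Hypothesis mf : measurable_fun setT (truncated_coef psi_inv h f D).
Hypothesis mg : measurable_fun setT (truncated_coef psi_inv h g D).

Local Notation Y := (tem_grid psi_inv h f g y0 W D).

(** Measurability of the scheme is needed for two sigma-algebras on the same
    space; the map [V] (the identity in both uses) changes the structure on the
    source. *)
Section sub_sigma_algebra.
Context {d' : measure_display} {Omega' : measurableType d'}.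
Variables (V : Omega' -> Omega) (n : nat).
Hypothesis mdW : forall j, (j < n)%N ->
  measurable_fun setT (fun w => W (j.+1%:R * D) (V w) - W (j%:R * D) (V w)).

Lemma measurable_tem_grid_comp k : (k <= n)%N ->
  measurable_fun setT (fun w => Y k (V w)).
Proof.
elim: k => [_|k IH kn] /=; first exact: measurable_cst.
have mY := IH (ltnW kn).
apply: measurable_funD; first apply: measurable_funD => //.
  by apply: measurable_funM => //; exact: (measurableT_comp mf).
apply: measurable_funM; last exact: mdW.
exact: (measurableT_comp mg).
Qed.
End sub_sigma_algebra.

Lemma measurable_increment s t : 0 <= s -> 0 <= t ->
  measurable_fun setT (W t \- W s).
Proof.
by move=> s0 t0; apply: measurable_funB; exact: (bm_measurable hW).
Qed.

Lemma measurable_tem_grid k : measurable_fun setT (Y k).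
Proof.
apply: (@measurable_tem_grid_comp _ _ id k) => // j _.
by apply: measurable_increment; rewrite mulr_ge0// ltW.
Qed.

(** The increments over the first [k] grid intervals and over [[k * D, s]] form
    an independent family, and the grid value is a function of the former. *)
Lemma tem_grid_independent k s (A B : set R) : k%:R * D < s ->
  measurable A -> measurable B ->
  P (Y k @^-1` A `&` (W s \- W (k%:R * D)) @^-1` B) =
  (P (Y k @^-1` A) * P ((W s \- W (k%:R * D))%R @^-1` B))%E.
Proof.
move=> ks mA mB.
(* Grid points up to [k * D], followed by [s]; the last increment is the one
   over [[k * D, s]]. *)
pose t (i : nat) : R := if (i <= k)%N then i%:R * D else s.
pose X (i : 'I_k.+1) := W (t i.+1) \- W (t i).
have tk : t k = k%:R * D by rewrite /t leqnn.
have tk1 : t k.+1 = s by rewrite /t ltnn.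
have s0 : 0 <= s by rewrite (le_trans _ (ltW ks))// mulr_ge0// ltW.
have t0 i : 0 <= t i by rewrite /t; case: ifP => // _; rewrite mulr_ge0// ltW.
have tmono i : (i < k.+1)%N -> t i <= t i.+1.
  rewrite ltnS /t => ik; rewrite ik; case: ifP => [_|ki].
    by rewrite ler_pM2r// ler_nat.
  have -> : i = k by apply/eqP; rewrite eqn_leq ik/= leqNgt ki.
  exact: ltW.
have mX i : measurable_fun setT (X i) by exact: measurable_increment.
have indep := bm_independent hW (t0 0%N) tmono.
have Xmax : X ord_max = W s \- W (k%:R * D) by rewrite /X /= tk tk1.
rewrite -Xmax.
apply: (generated_past_independent mX indep) => //.
pose G := past_cylinders X.
rewrite -[X in <<s _ >> X]setTI.
apply: (@measurable_tem_grid_comp _ (g_sigma_algebraType G) id k) => //.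
move=> j jk _ C mC; rewrite setTI; apply: sub_sigma_algebra.
(* The [j]-th grid increment is constrained, all others are free. *)
exists (fun i => if i == widen_ord (leqnSn k) (Ordinal jk) then C else setT).
split.
- by move=> i; case: ifP.
- by rewrite ifF//; apply/negbTE; rewrite neq_ltn/= jk orbT.
- apply/seteqP; split =>
    [w Cw i _|w /(_ (widen_ord (leqnSn k) (Ordinal jk)) I)].
    rewrite /preimage/=; case: eqP => // ->.
    by rewrite /X /t/= (ltnW jk) jk.
  by rewrite /preimage/= eqxx /X /t/= (ltnW jk) jk.
Qed.
End scheme_measurability.

(** * Propagation of the exponential moment *)

Section gaussian_increment.
Context {d : measure_display} {Omega : measurableType d} {R : realType}.
Variables (P : probability Omega R) (W : R -> Omega -> R).
Hypothesis hW : brownian_motion P W.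

Lemma integral_increment (s t : R) (phi : R -> \bar R) : 0 <= s -> s < t ->
  measurable_fun setT phi -> (forall x, 0 <= phi x)%E ->
  (\int[P]_w phi (W t w - W s w)%R =
   \int[normal_prob 0%R (Num.sqrt (t - s))]_x phi x)%E.
Proof.
move=> s0 st mphi phi0.
have mZ : measurable_fun setT (W t \- W s : Omega -> measurableTypeR R).
  by apply: (measurable_increment hW) => //; exact: le_trans (ltW st).
(* [normal_prob] lives on the Borel structure [measurableTypeR R]. *)
pose Z : {mfun Omega >-> measurableTypeR R} :=
  HB.pack (W t \- W s : Omega -> measurableTypeR R)
    (isMeasurableFun.Build _ _ _ _ _ mZ).
rewrite -[LHS](ge0_integral_distribution Z)//.
by apply: eq_measure_integral => A mA _; exact: (bm_gaussian hW).
Qed.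

End gaussian_increment.

Section moments.
Context {d : measure_display} {Omega : measurableType d} {R : realType}.
Variables (P : probability Omega R) (W : R -> Omega -> R).
Hypothesis hW : brownian_motion P W.
Variables (psi_inv h f g : R -> R) (y0 D m K c lam0 : R).
Hypothesis D0 : 0 < D.
Local Notation fD := (truncated_coef psi_inv h f D).
Local Notation gD := (truncated_coef psi_inv h g D).
Local Notation Y := (tem_grid psi_inv h f g y0 W D).
Local Notation V := (lyapunov m^-1).
Local Notation C := (4 * 11 `^ m * K).
Hypothesis mf : measurable_fun setT fD.
Hypothesis mg : measurable_fun setT gD.
Hypotheses (m1 : 1 <= m) (K0 : 0 < K).
Hypothesis hfg : forall p y : R, 2 < p ->
  y * f y + (p - 1) / 2 * (g y) ^+ 2 <= K * (p `^ m).
Hypothesis trunc_ge1 : 1 <= psi_inv (h D).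
Hypothesis fD_bound : forall a, fD a ^+ 2 * D <= c ^+ 2.
Hypothesis gD_bound : forall a, gD a ^+ 2 * D <= c ^+ 2.
Hypotheses (lam0_le1 : lam0 <= 1) (lam0_c : 4 * lam0 * c ^+ 2 <= 1).

(** The drift bound makes the exponent [lam * (1 + C * del) * V a + del], and
    [1 + C * del <= expR (C * del)] puts it in a form that composes. *)
Lemma one_step_conditional (lam del a : R) : 0 < lam <= lam0 -> 0 < del <= D ->
  (\int[normal_prob 0%R (Num.sqrt del)]_x
     (expR (lam * V (a + del * fD a + gD a * x)))%:E <=
   (expR (lam * expR (C * del) * V a + del))%:E)%E.
Proof.
move=> /andP[l0 l1] /andP[del0 delD].
have m0 : 0 < m := lt_le_trans ltr01 m1.
have th01 : 0 < m^-1 <= 1 by rewrite invr_gt0 m0 invf_le1.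
have small x : x ^+ 2 * D <= c ^+ 2 -> x ^+ 2 * del <= c ^+ 2.
  by apply: le_trans; rewrite ler_wpM2l ?sqr_ge0.
have lc : 4 * lam * c ^+ 2 <= 1.
  by apply: le_trans lam0_c; rewrite ler_wpM2r ?sqr_ge0// ler_pM2l.
apply: le_trans (gaussian_step a th01 l0 lc del0 (small _ (fD_bound a))
  (small _ (gD_bound a))) _.
rewrite lee_fin ler_expR lerD2r.
have [rho ab [rho1 rhov]] := truncation_factor a trunc_ge1.
have ll : 0 < lam <= 1 by rewrite l0 (le_trans l1).
have := drift_le_lyapunov m1 K0 hfg ab rho1 rhov ll.
rewrite -/(truncated_coef psi_inv h f D a) -/(truncated_coef psi_inv h g D a).
set S := (X in X <= _); rewrite -/S => hS.
apply: (@le_trans _ _ (lam * (1 + C * del) * V a)).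
  have -> : lam * (1 + C * del) * V a =
      lam * V a + 2 * del * (2 * 11 `^ m * K * (lam * V a)) by ring.
  by rewrite lerD2l ler_pM2l// mulr_gt0.
rewrite ler_wpM2r ?lyapunov_ge0// ler_pM2l//; exact: expR_ge1Dx.
Qed.

Lemma measurable_exp_lyapunov (lam th : R) :
  measurable_fun [set: R] (fun y => (expR (lam * lyapunov th y))%:E).
Proof.
apply/measurable_EFinP; apply: measurableT_comp => //.
by apply: measurable_funM => //; exact: measurable_lyapunov.
Qed.

Lemma one_step_moment (lam del : R) k : 0 < lam <= lam0 -> 0 < del <= D ->
  (\int[P]_w (expR (lam * V (Y k w + del * fD (Y k w) +
     gD (Y k w) * (W (k%:R * D + del) w - W (k%:R * D) w))))%:E <=
   (expR del)%:E * \int[P]_w (expR (lam * expR (C * del) * V (Y k w)))%:E)%E.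
Proof.
move=> lamP delP; have /andP[del0 _] := delP.
have kD0 : 0 <= k%:R * D by rewrite mulr_ge0// ltW.
have kdel : k%:R * D < k%:R * D + del by rewrite ltrDl.
have kdel0 := le_trans kD0 (ltW kdel).
pose Phi (z : R * R) : \bar R :=
  (expR (lam * V (z.1 + del * fD z.1 + gD z.1 * z.2)))%:E.
have mPhi : measurable_fun setT Phi.
  apply: (measurableT_comp (measurable_exp_lyapunov lam m^-1)).
  apply: measurable_funD; first apply: measurable_funD => //.
    by apply: measurable_funM => //; exact: (measurableT_comp mf).
  by apply: measurable_funM => //; exact: (measurableT_comp mg).
have mY := measurable_tem_grid hW y0 D0 mf mg k.
pose Z := W (k%:R * D + del) \- W (k%:R * D).
have mZ : measurable_fun setT Z by exact: (measurable_increment hW).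
have mexp del' : measurable_fun [set: Omega]
    (fun w => (expR (del' * V (Y k w)))%:E).
  exact: (measurableT_comp (measurable_exp_lyapunov _ _) mY).
rewrite [leLHS](_ : _ = \int[P]_w
    \int[P]_w' Phi (Y k w, Z w'))%E; last first.
  apply: (@integral_independent _ _ _ P _ _ _ _ (Y k) Z Phi) => //.
  - by move=> A B mA mB; exact: (tem_grid_independent hW).
  - by move=> z; rewrite lee_fin expR_ge0.
rewrite -ge0_integralZl//.
apply: ge0_le_integral => //.
- by move=> w _; apply: integral_ge0 => w' _; rewrite lee_fin expR_ge0.
- apply: (measurable_fun_fubini_tonelli_F (m2 := P)
    (fun z : Omega * Omega => Phi (Y k z.1, Z z.2))) => //.
    apply: (measurableT_comp mPhi); apply: measurable_fun_pair => /=.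
      exact: (measurableT_comp mY).
    exact: (measurableT_comp mZ).
  by move=> z; rewrite lee_fin expR_ge0.
- exact: emeasurable_funM.
move=> w _.
rewrite (@integral_increment _ _ _ P W hW _ _ (fun x => Phi (Y k w, x)))//.
  rewrite /= addrAC subrr add0r.
  apply: le_trans (one_step_conditional _ lamP delP) _.
  by rewrite -EFinM -expRD addrC.
  exact: measurableT_comp.
by move=> x; rewrite lee_fin expR_ge0.
Qed.

(** Induction on [k] for all [lam] at once: the last step turns [lam] into
    [lam * expR (C * D)], to which the bound at time [k * D] is applied. *)
Lemma grid_moment (lam : R) k :
  0 < lam -> lam * expR (C * (k%:R * D)) <= lam0 ->
  (\int[P]_w (expR (lam * V (Y k w)))%:E <=
   (expR (lam * expR (C * (k%:R * D)) * V y0 + k%:R * D))%:E)%E.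
Proof.
elim: k lam => [|k IH] lam l0 l1.
  rewrite mul0r mulr0 expR0 mulr1 addr0 /=.
  by rewrite integral_cst//= probability_setT mule1.
have C0 : 0 < C by rewrite !mulr_gt0// powR_gt0.
have kSE : k.+1%:R * D = k%:R * D + D by rewrite -addn1 natrD mulrDl mul1r.
have split_exp : expR (C * (k.+1%:R * D)) =
    expR (C * D) * expR (C * (k%:R * D)).
  by rewrite kSE -expRD; congr expR; ring.
rewrite split_exp mulrA in l1 *.
have lamk : 0 < lam <= lam0.
  rewrite l0 (le_trans _ l1)// -mulrA ler_peMr ?(ltW l0)//.
  rewrite -expRD (le_trans _ (expR_ge1Dx _))// lerDl.
  apply: addr_ge0; apply: mulr_ge0; rewrite ?(ltW C0) ?(ltW D0)//.
  by rewrite mulr_ge0 ?(ltW D0).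
have DD : 0 < D <= D by rewrite D0 lexx.
have := one_step_moment k lamk DD.
rewrite /= -kSE => /le_trans; apply.
apply: le_trans.
  apply: lee_wpmul2l; first by rewrite lee_fin expR_ge0.
  by apply: IH => //; rewrite mulr_gt0// expR_gt0.
rewrite -EFinM -expRD lee_fin ler_expR kSE; lra.
Qed.

Lemma intermediate_moment (lam del : R) k : 0 <= del <= D -> 0 < lam ->
  lam * expR (C * (k%:R * D + del)) <= lam0 ->
  (\int[P]_w (expR (lam * V (Y k w + del * fD (Y k w) +
     gD (Y k w) * (W (k%:R * D + del) w - W (k%:R * D) w))))%:E <=
   (expR (lam * expR (C * (k%:R * D + del)) * V y0 + (k%:R * D + del)))%:E)%E.
Proof.
move=> /andP[del0 delD] l0 l1.
have C0 : 0 < C by rewrite !mulr_gt0// powR_gt0.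
have kD0 : 0 <= k%:R * D by rewrite mulr_ge0// ltW.
move: del0; rewrite le_eqVlt => /predU1P[del0|del0].
  move: l1; rewrite -del0 !addr0 => l1.
  under eq_integral do rewrite mul0r subrr mulr0 !addr0.
  exact: grid_moment.
have split_exp : expR (C * (k%:R * D + del)) =
    expR (C * del) * expR (C * (k%:R * D)).
  by rewrite -expRD; congr expR; ring.
rewrite split_exp mulrA in l1 *.
have lamk : 0 < lam <= lam0.
  rewrite l0 (le_trans _ l1)// -mulrA ler_peMr ?(ltW l0)//.
  rewrite -expRD (le_trans _ (expR_ge1Dx _))// lerDl.
  by apply: addr_ge0; apply: mulr_ge0 => //; exact: ltW.
have delP : 0 < del <= D by rewrite del0.
apply: le_trans (one_step_moment k lamk delP) _.
apply: le_trans.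
  apply: lee_wpmul2l; first by rewrite lee_fin expR_ge0.
  by apply: grid_moment => //; rewrite mulr_gt0// expR_gt0.
rewrite -EFinM -expRD lee_fin ler_expR; lra.
Qed.

End moments.

(** * The continuous-time process *)

Section interpolation.
Context {R : realType} {Omega : Type}.
Local Notation mu := lebesgue_measure.

Lemma integral_cst_piece (phi : R -> R) (a b c : R) : a <= b ->
  (forall s, a <= s < b -> phi s = c) ->
  measurable_fun `[a, b[ phi /\
  (\int[mu]_(s in `[a, b[) (phi s)%:E = ((b - a) * c)%:E)%E.
Proof.
move=> ab phic; have phiE : {in `[a, b[%classic, phi =1 cst c}.
  by move=> s; rewrite inE/= in_itv/= => /phic.
split.
  by apply: (eq_measurable_fun (cst c)) => // s sab; rewrite phiE.
rewrite (eq_integral (cst c%:E)) => [|s sab]; last by rewrite phiE.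
rewrite integral_cst//= lebesgue_measure_itv/= lte_fin.
move: ab; rewrite le_eqVlt => /predU1P[->|ab].
  by rewrite ltxx subrr mul0r mule0.
by rewrite ab -EFinD -EFinM mulrC.
Qed.

(** On the half-open intervals the function is exactly constant; the value at
    the right end point [t] may already be that of the next piece. *)
Lemma integral_step_fun (phi : R -> R) (v : nat -> R) (D : R) : 0 < D ->
  (forall k s, k%:R * D <= s < k.+1%:R * D -> phi s = v k) ->
  forall k t, k%:R * D <= t <= k.+1%:R * D ->
  measurable_fun `[0, t[ phi /\
  (\int[mu]_(s in `[0%R, t[) (phi s)%:E =
   (\sum_(j < k) D * v j + (t - k%:R * D) * v k)%:E)%E.
Proof.
move=> D0 phiv; elim=> [|k IH] t /andP[kt tk].
  have t0 : 0 <= t by rewrite mul0r in kt.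
  rewrite big_ord0 mul0r add0r; apply: integral_cst_piece => // s /andP[s0 st].
  by apply: phiv; rewrite mul0r s0 (lt_le_trans st).
have kk : k%:R * D <= k.+1%:R * D <= k.+1%:R * D.
  by rewrite lexx andbT ler_pM2r// ler_nat.
have [m1 i1] := IH _ kk.
have [|m2 i2] := @integral_cst_piece phi (k.+1%:R * D) t (v k.+1) kt.
  by move=> s /andP[s0 st]; apply: phiv; rewrite s0 (lt_le_trans st).
have kD0 : 0 <= k.+1%:R * D by rewrite mulr_ge0// ltW.
have split_itv : `[0, t[%classic =
    `[0, (k.+1%:R * D)[%classic `|` `[(k.+1%:R * D), t[%classic.
  by apply: itv_bndbnd_setU; rewrite bnd_simp.
rewrite split_itv; have mU : measurable_fun (`[0, (k.+1%:R * D)[%classic `|`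
    `[(k.+1%:R * D), t[%classic) phi by apply/measurable_funU.
split => //; rewrite integral_setU_EFin//=.
  rewrite i1 i2 -EFinD; congr EFin; rewrite big_ord_recr/=; congr (_ + _ + _).
  by rewrite -mulrBl -natrB// subSnn mul1r.
apply/disj_setPS => s [] /=; rewrite !in_itv/= => /andP[_ s1] /andP[s2 _].
by move: (lt_le_trans s1 s2); rewrite ltxx.
Qed.

Lemma tem_stepE (psi_inv h f g : R -> R) (y0 : R) (W : R -> Omega -> R)
    (D : R) (k : nat) (s : R) w : 0 < D -> k%:R * D <= s < k.+1%:R * D ->
  tem_step psi_inv h f g y0 W D s w = tem_grid psi_inv h f g y0 W D k w.
Proof.
move=> D0 ks; rewrite /tem_step; congr tem_grid; apply: truncn_def.
by rewrite ler_pdivlMr// ltr_pdivrMr.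
Qed.

(** Between grid points the continuous-time process is one Euler step of
    length [del] from the last grid value, so one-step estimates cover it. *)
Lemma temE (psi_inv h f g : R -> R) (y0 : R) (W : R -> Omega -> R)
    (D : R) (k : nat) (del : R) w : 0 < D -> 0 <= del < D ->
  let Y := tem_grid psi_inv h f g y0 W D k w in
  tem psi_inv h f g y0 W D (k%:R * D + del) w =
  Y + del * truncated_coef psi_inv h f D Y +
  truncated_coef psi_inv h g D Y * (W (k%:R * D + del) w - W (k%:R * D) w).
Proof.
move=> D0 /andP[del0 delD] Y.
set t := k%:R * D + del.
have kt : k%:R * D <= t by rewrite lerDl.
have tk : t < k.+1%:R * D.
  by rewrite -addn1 natrD mulrDl mul1r ltrD2l.
pose X j := tem_grid psi_inv h f g y0 W D j w.
have stepE j s : j%:R * D <= s < j.+1%:R * D ->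
    tem_step psi_inv h f g y0 W D s w = X j by exact: tem_stepE.
have trunct : Num.truncn (t / D) = k.
  by apply: truncn_def; rewrite ler_pdivlMr// ltr_pdivrMr// kt.
pose phi s := truncated_coef psi_inv h f D (tem_step psi_inv h f g y0 W D s w).
pose v j := truncated_coef psi_inv h f D (X j).
have phiv j s : j%:R * D <= s < j.+1%:R * D -> phi s = v j.
  by move=> js; rewrite /phi (stepE j).
have ktk : k%:R * D <= t <= k.+1%:R * D by rewrite kt ltW.
have [mphi int_drift] := integral_step_fun D0 phiv ktk.
rewrite /tem /Rintegral.
rewrite -(integral_itv_bndo_bndc (f := EFin \o phi)); last first.
  exact/measurable_EFinP.
rewrite int_drift /= /ito_step_integral trunct big_ord_recr/=.
rewrite (min_l (x := t)) ?ltW// (min_r (x := t))//.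
have gridE j : X j = y0 + \sum_(i < j) D * truncated_coef psi_inv h f D (X i) +
    \sum_(i < j) truncated_coef psi_inv h g D (X i) *
      (W (i.+1%:R * D) w - W (i%:R * D) w).
  elim: j => [|j IH]; first by rewrite !big_ord0 !addr0.
  rewrite !big_ord_recr/= {1}/X /= -/(X j) {1}IH; ring.
have -> : \sum_(i < k) truncated_coef psi_inv h g D
      (tem_step psi_inv h f g y0 W D (i%:R * D) w) *
      (W (Num.min t (i.+1%:R * D)) w - W (Num.min t (i%:R * D)) w) =
    \sum_(i < k) truncated_coef psi_inv h g D (X i) *
      (W (i.+1%:R * D) w - W (i%:R * D) w).
  apply: eq_bigr => i _; rewrite (stepE i); last first.
    by rewrite lexx ltr_pM2r// ltr_nat//=.
  rewrite !min_r//; apply: le_trans kt; rewrite ler_pM2r// ler_nat//.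
  exact: ltnW.
rewrite (stepE k); last by rewrite lexx ltr_pM2r// ltr_nat//=.
rewrite /Y -/(X k) [X in _ = X + _ + _]gridE {1}/t /v; ring.
Qed.
End interpolation.

(** * Uniform exponential integrability *)

(** With [r = 2 / m > 1], [lam * |y| `^ r] exceeds [q * |y|] as soon as [|y|]
    is beyond [M = (q / lam) `^ (r - 1)^-1]; below [M], [q * M] does. *)
Lemma linear_le_lyapunov (R : realType) (m q lam : R) :
  1 <= m < 2 -> 0 < q -> 0 < lam ->
  exists c : R, forall y : R, q * `|y| <= lam * lyapunov m^-1 y + c.
Proof.
move=> /andP[m1 m2] q0 lam0; have m0 : 0 < m by lra.
pose r := 2 * m^-1.
have r1 : 0 < r - 1 by rewrite /r subr_gt0 ltr_pdivlMr// mul1r.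
have r0 : 0 < r by lra.
pose M := (q / lam) `^ (r - 1)^-1.
have ql : 0 < q / lam by rewrite divr_gt0.
have M0 : 0 < M by rewrite powR_gt0.
exists (q * M) => y; have y0 := normr_ge0 y.
have lyap : `|y| `^ r <= lyapunov m^-1 y.
  have im0 : 0 <= m^-1 by rewrite invr_ge0 ltW.
  rewrite /lyapunov /r powRrM powR_mulrn// real_normK ?num_real//.
  by apply: ge0_ler_powR => //; rewrite ?nnegrE ?addr_ge0 ?sqr_ge0// lerDr.
have [yM|My] := leP `|y| M.
  apply: (@le_trans _ _ (q * M)); first by rewrite ler_pM2l.
  by rewrite lerDr mulr_ge0 ?(ltW lam0)// powR_ge0.
apply: (@le_trans _ _ (lam * `|y| `^ r)); last first.
  apply: (@le_trans _ _ (lam * lyapunov m^-1 y)); first by rewrite ler_pM2l.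
  by rewrite lerDl mulr_ge0// ltW.
have yr : `|y| * `|y| `^ (r - 1) = `|y| `^ r by exact: mulr_powRB1.
rewrite -yr mulrCA [leLHS]mulrC ler_wpM2l// mulrC -ler_pdivrMr//.
have <- : M `^ (r - 1) = q / lam.
  by rewrite /M -powRrM mulVf ?lt0r_neq0// powRr1// ltW.
by apply: ge0_ler_powR; rewrite ?nnegrE ?(ltW r1) ?(ltW M0) ?(ltW My).
Qed.

Theorem theorem4p10 (R : realType) (d : measure_display)
    (Omega : measurableType d) (P : probability Omega R)
    (W : R -> Omega -> R) (hW : brownian_motion P W)
    (T : R) (hT : 0 < T) (y0 : R) (f g : R -> R)
    (hf : locally_lipschitz f) (hg : locally_lipschitz g)
    (m K : R) (hm1 : 1 <= m) (hK : 0 < K)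
    (hfg : forall p y : R, 2 < p ->
      y * f y + (p - 1) / 2 * (g y) ^+ 2 <= K * (p `^ m))
    (psi psi_inv : R -> R)
    (psi_pos : forall r, 1 <= r -> 0 < psi r)
    (psi_incr : forall r s, 1 <= r -> r < s -> psi r < psi s)
    (psi_lim : psi r @[r --> +oo] --> +oo)
    (psi_invE : forall r, 1 <= r -> psi_inv (psi r) = r)
    (psi_inv_ge1 : forall u, psi 1 <= u -> 1 <= psi_inv u)
    (psiE : forall u, psi 1 <= u -> psi (psi_inv u) = u)
    (psi_inv_incr : forall u v, psi 1 <= u -> u < v -> psi_inv u < psi_inv v)
    (psi_bound : forall r y, 1 <= r -> `|y| <= r ->
      Num.max `|f y| `|g y| <= psi r)
    (h : R -> R) (c0 : R) (hc0 : Num.max 1 (psi 1) <= c0)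
    (h_ge : forall D, 0 < D <= 1 -> psi 1 <= h D)
    (h_decr : forall D E, 0 < D -> D < E -> E <= 1 -> h E < h D)
    (h_lim : h D @[D --> 0^'+] --> +oo)
    (h_bound : forall D, 0 < D <= 1 -> D `^ (4^-1) * h D <= c0)
    (hm2 : m < 2) :
  forall q : R, 0 < q ->
    (ereal_sup [set ereal_sup
       [set 'E_P[fun w => expR (q * `|tem psi_inv h f g y0 W D t w|)]
       | t in `[0%R, T]]
     | D in step_sizes T] < +oo)%E.
Proof.
move=> q q0.
have c1 : 1 <= c0 by apply: le_trans hc0; rewrite le_max lexx.
have c0_gt0 : 0 < c0 := lt_le_trans ltr01 c1.
have c2 : 1 <= c0 ^+ 2 by rewrite exprn_ege1.
have c2_gt0 : 0 < c0 ^+ 2 := lt_le_trans ltr01 c2.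
pose lam0 := (4 * c0 ^+ 2)^-1.
have lam0_gt0 : 0 < lam0 by rewrite invr_gt0 mulr_gt0.
have lam0c : 4 * lam0 * c0 ^+ 2 <= 1.
  rewrite le_eqVlt /lam0; apply/orP; left; apply/eqP.
  by field; rewrite lt0r_neq0.
have lam0_le1 : lam0 <= 1 by rewrite /lam0 invf_le1 ?mulr_gt0//; lra.
pose C := 4 * 11 `^ m * K.
have C0 : 0 < C by rewrite !mulr_gt0// powR_gt0.
(* Every step inflates [lam]; starting this low, it is at most [lam0] when the
   backward iteration reaches time 0. *)
pose lam := lam0 * expR (- (C * T)).
have lam_gt0 : 0 < lam by rewrite mulr_gt0// expR_gt0.
have [b qb] : exists b : R, forall y : R,
    q * `|y| <= lam * lyapunov m^-1 y + b.
  by apply: linear_le_lyapunov => //; rewrite hm1.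
pose B := expR (lam0 * lyapunov m^-1 y0 + T + b).
apply: (@le_lt_trans _ _ B%:E); last exact: ltry.
apply: ge_ereal_sup => _ [D [/andP[D0 D1] _] <-].
apply: ge_ereal_sup => _ [t /= + <-]; rewrite in_itv/= => /andP[t0 tT].
have D01 : 0 < D <= 1 by rewrite D0 D1.
have mf : measurable_fun setT f.
  by apply: continuous_measurable_fun; exact: locally_lipschitz_continuous.
have mg : measurable_fun setT g.
  by apply: continuous_measurable_fun; exact: locally_lipschitz_continuous.
have trunc_ge1 : 1 <= psi_inv (h D) by apply: psi_inv_ge1; exact: h_ge.
have trunc_ge0 := le_trans ler01 trunc_ge1.
have hD0 : 0 <= h D by rewrite (le_trans _ (h_ge _ D01))// ltW// psi_pos.
have hD2 : h D ^+ 2 * D <= c0 ^+ 2.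
  pose e := D `^ 4^-1; have e0 : 0 <= e by exact: powR_ge0.
  have e1 : e <= 1.
    rewrite -[leRHS](congr1 (@^~ 4^-1) (powR1 R)).
    by apply: ge0_ler_powR; rewrite ?nnegrE ?(ltW D0).
  have De : D = e ^+ 4.
    by rewrite -powR_mulrn// -powRrM mulVf// powRr1// ltW.
  have eh : e * h D <= c0 by exact: h_bound.
  have eh0 : 0 <= e * h D by rewrite mulr_ge0.
  have eh2 : (e * h D) ^+ 2 <= c0 ^+ 2.
    by rewrite ler_pXn2r ?nnegrE ?(ltW c0_gt0).
  apply: le_trans eh2.
  have -> : h D ^+ 2 * D = e ^+ 2 * (e * h D) ^+ 2 by rewrite {2}De; ring.
  by rewrite ler_piMl ?sqr_ge0// exprn_ile1.
have coef_bound (a : R -> R) x :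
    (forall y, `|y| <= psi_inv (h D) -> `|a y| <= h D) ->
    truncated_coef psi_inv h a D x ^+ 2 * D <= c0 ^+ 2.
  move=> abound; apply: le_trans hD2.
  rewrite ler_pM2r// -real_normK ?num_real//.
  rewrite ler_pXn2r ?nnegrE//; apply: abound.
  rewrite truncationE// ler_norml le_max lexx/= ge_max ge_min lexx orbT andbT.
  by rewrite (le_trans _ trunc_ge0) ?oppr_le0.
have fD_bound x : truncated_coef psi_inv h f D x ^+ 2 * D <= c0 ^+ 2.
  apply: coef_bound => y /(psi_bound _ _ trunc_ge1); rewrite psiE ?h_ge//.
  by rewrite ge_max => /andP[].
have gD_bound x : truncated_coef psi_inv h g D x ^+ 2 * D <= c0 ^+ 2.
  apply: coef_bound => y /(psi_bound _ _ trunc_ge1); rewrite psiE ?h_ge//.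
  by rewrite ge_max => /andP[].
have mfD : measurable_fun setT (truncated_coef psi_inv h f D).
  exact: measurable_truncated_coef.
have mgD : measurable_fun setT (truncated_coef psi_inv h g D).
  exact: measurable_truncated_coef.
pose k := Num.truncn (t / D).
have /andP[kt tk] : k%:R <= t / D < k.+1%:R.
  by apply: truncn_itv; rewrite divr_ge0// ltW.
rewrite ler_pdivlMr// in kt; rewrite ltr_pdivrMr// in tk.
pose del := t - k%:R * D.
have tE : t = k%:R * D + del by rewrite /del addrC subrK.
have delP : 0 <= del < D.
  rewrite subr_ge0 kt/= /del ltrBlDr.
  by rewrite -addn1 natrD mulrDl mul1r addrC in tk.
have delP' : 0 <= del <= D by have /andP[-> /ltW] := delP.
have lam_t : lam * expR (C * t) <= lam0.
  rewrite /lam -mulrA -expRD ger_pMr// -[leRHS]expR0 ler_expR.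
  by rewrite addrC subr_le0 ler_pM2l.
have := intermediate_moment hW y0 D0 mfD mgD hm1 hK hfg trunc_ge1 fD_bound
  gD_bound lam0_le1 lam0c (k := k) delP' lam_gt0.
rewrite -/C -tE => /(_ lam_t) moment.
rewrite unlock.
(* [t] is the last grid point [k * D] plus [del]. *)
have temtE w : tem psi_inv h f g y0 W D t w =
    tem_grid psi_inv h f g y0 W D k w +
    del * truncated_coef psi_inv h f D (tem_grid psi_inv h f g y0 W D k w) +
    truncated_coef psi_inv h g D (tem_grid psi_inv h f g y0 W D k w) *
      (W t w - W (k%:R * D) w).
  by rewrite tE (temE _ _ _ _ _ _ _ _ D0 delP).
have mY := measurable_tem_grid hW y0 D0 mfD mgD k.
have mtem : measurable_fun setT (fun w => tem psi_inv h f g y0 W D t w).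
  under eq_fun do rewrite temtE.
  apply: measurable_funD; first apply: measurable_funD => //.
    by apply: measurable_funM => //; exact: (measurableT_comp mfD).
  apply: measurable_funM; first exact: (measurableT_comp mgD).
  by apply: (measurable_increment hW) => //; rewrite mulr_ge0// ltW.
have mexp := measurableT_comp (measurable_exp_lyapunov lam m^-1) mtem.
apply: (@le_trans _ _ (\int[P]_w ((expR b)%:E *
    (expR (lam * lyapunov m^-1 (tem psi_inv h f g y0 W D t w)))%:E))%E).
  apply: ge0_le_integral => //.
  - apply/measurable_EFinP; apply: measurableT_comp => //.
    apply: measurable_funM => //; exact: measurableT_comp.
  - exact: emeasurable_funM.
  - by move=> w _; rewrite -EFinM lee_fin -expRD ler_expR addrC.
rewrite ge0_integralZl//.
under eq_integral do rewrite temtE.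
apply: (@le_trans _ _ ((expR b)%:E *
  (expR (lam * expR (C * t) * lyapunov m^-1 y0 + t))%:E)%E).
  by apply: lee_wpmul2l => //; rewrite lee_fin expR_ge0.
rewrite -EFinM -expRD lee_fin ler_expR addrC lerD2r lerD//.
by rewrite ler_wpM2r// lyapunov_ge0.
Qed.
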